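(* Let $k\ge 3$ be a fixed integer. For $n\ge 1$, let $t=t(n)$ and $b=b(n)$ be integer-valued functions of $n$ with $0\le b\le t\le n$ and $t\ge 1$. All asymptotics are as $n\to\infty$. (1) If $t=\omega(n^{1-2/k})$ and $b=\omega\bigl((n/t)^{\frac{k-2}{2}}\bigr)$, then there is a $(t,b)$-strategy (one for each $n$) that with high probability constructs a $k$-AP; that is, the probability that the set of integers purchased by Builder contains a $k$-AP tends to $1$ as $n\to\infty$. (2) Conversely, if $t=o(n^{1-2/k})$ or $b=o\bigl((n/t)^{\frac{k-2}{2}}\bigr)$, then any $(t,b)$-strategy (that is, any choice of a $(t,b)$-strategy for each $n$) with high probability fails to construct a $k$-AP; that is, the probability that the set of integers purchased by Builder contains a $k$-AP tends to $0$ as $n\to\infty$.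
   Context: Write $[n]=\{1,\dots,n\}$. A (non-trivial) $k$-term arithmetic progression, or $k$-AP, is a set of the form $\{a,a+d,\dots,a+(k-1)d\}$ with $a,d$ integers and $d\ge 1$. $(t,b)$-strategy: Let $0\le b\le t\le n$ be integers. Let $X_1,\dots,X_n$ be a uniformly random permutation of $[n]$. A $(t,b)$-strategy is a possibly randomised online algorithm for a player called Builder. During round $s\in[t]$, Builder is shown $X_s$ and must decide immediately and irrevocably whether to purchase it. This decision may depend only on the integers $X_1,\dots,X_s$, the previous purchase decisions, and the internal randomness of the strategy (which is independent of the random permutation). Builder may purchase at most $b$ integers in total. A $(t,b)$-strategy succeeds, i.e. constructs a $k$-AP, if the set of purchased integers (after round $t$) contains a $k$-AP. The parameter $k$ is fixed and $n\to\infty$. An event (depending on $n$) holds with high probability if its probability tends to $1$ as $n\to\infty$. For nonnegative $f$ and positive $g$, $f=o(g)$ means $f(n)/g(n)\to 0$ and $f=\omega(g)$ means $f(n)/g(n)\to\infty$ as $n\to\infty$. *)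

(* Defs.v *)
From HB Require Import structures.
From mathcomp Require Import all_boot all_order all_algebra all_fingroup.
From mathcomp Require Import all_classical all_reals all_analysis.
Set Implicit Arguments.
Unset Strict Implicit.
Unset Printing Implicit Defensive.
Import Order.TTheory GRing.Theory Num.Theory.
Import numFieldNormedType.Exports.
Local Open Scope classical_set_scope.
Local Open Scope ring_scope.

Definition contains_AP (k : nat) (A : seq nat) : Prop :=
  exists a d : int, 1 <= d /\
    forall i : nat, (i < k)%N -> exists2 x : nat, x \in A & x%:Z = a + i%:Z * d.

(* The integers X_1, ..., X_n. Elements of 'I_n are shifted by one, so that the
   values are permuted elements of {1, ..., n}. *)
Definition revealed (n : nat) (p : {perm 'I_n}) : seq nat :=
  [seq (p i).+1 | i <- enum 'I_n].

(* A decision rule [buy] maps [:: X_1; ...; X_s] and the decisions made in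
   rounds 1, ..., s-1 to the decision made in round s. *)
Fixpoint decisions (buy : seq nat -> seq bool -> bool) (xs : seq nat) (s : nat)
  : seq bool :=
  if s is s'.+1 then
    let ds := decisions buy xs s' in rcons ds (buy (take s xs) ds)
  else [::].

Definition purchased (buy : seq nat -> seq bool -> bool) (xs : seq nat)
  (t : nat) : seq nat := mask (decisions buy xs t) xs.

(* The internal randomness is a point of an arbitrary probability space. *)
Record strategy (R : realType) (n t b : nat) := Strategy {
  seed_display : measure_display;
  seed : measurableType seed_display;
  seed_law : probability seed R;
  buy : seed -> seq nat -> seq bool -> bool;
  measurable_buy : forall (xs : seq nat) (ds : seq bool),
    measurable [set w : seed | buy w xs ds];
  budget : forall (w : seed) (p : {perm 'I_n}),
    (size (purchased (buy w) (revealed p) t) <= b)%N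
}.

(* Probability of success under the product of the uniform distribution on
   permutations and the law of the seed (the two are independent). *)
Definition success_probability (R : realType) (n t b : nat)
  (S : strategy R n t b) (k : nat) : R :=
  (\sum_(p : {perm 'I_n})
     fine (seed_law S
       [set w | contains_AP k (purchased (buy (s := S) w) (revealed p) t)]))
  / (n`!)%:R.

Definition little_o (R : realType) (f g : nat -> R) : Prop :=
  f n / g n @[n --> \oo] --> (0 : R).

Definition little_omega (R : realType) (f g : nat -> R) : Prop :=
  f n / g n @[n --> \oo] --> +oo.

(* Main.v *)
(* Impossibility: if Builder completes a k-AP, let i < j be the rounds in which
   its first two elements were bought.  At most b^2 pairs of purchases and k^2
   pairs of places in the progression are possible, each choice determines the
   other k - 2 elements, and given the first j values these all show up between
   rounds j and t with probability at most (t/n)^(k-2).  So success has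
   probability at most k^2 b^2 (t/n)^(k-2).  As b <= t, this also covers the case
   of small t.

   Construction: Builder buys every integer of an initial interval [1, kL] with
   L about bn/(2kt), so that about b/2 purchases are expected.  Chebyshev's
   inequality bounds the probability of exceeding the budget, and also the
   probability that no progression a, a+d, ..., a+(k-1)d with a, d <= L is fully
   revealed by round t: the expected number of revealed ones is of order
   L^2 (t/n)^k, that is, b^2 (t/n)^(k-2). *)
Require Import Defs.
From HB Require Import structures.
From mathcomp Require Import all_boot all_order all_algebra all_fingroup.
From mathcomp Require Import all_classical all_reals all_analysis.
From mathcomp Require Import measurable_realfun ring lra zify.
Import Order.TTheory GRing.Theory Num.Theory.
Import numFieldNormedType.Exports.
Set Implicit Arguments.
Unset Strict Implicit.

(** * Positions of values in a random permutation *)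

Lemma card_sum_pred (T : finType) (P : pred T) : #|P| = (\sum_x P x)%N.
Proof.
by rewrite -sum1_card big_mkcond; apply: eq_bigr => x _; rewrite unfold_in; case: (P x).
Qed.

(* Values and rounds are counted from 0 here, unlike in [revealed]. *)
Definition early {n : nat} (t : nat) (p : {perm 'I_n}) (A : {set 'I_n}) : bool :=
  [forall x in A, (p^-1%g x < t)%N].

Lemma card_positions (n s t : nat) : (t <= n)%N ->
  #|[pred c : 'I_n | (s <= c < t)%N]| = (t - s)%N.
Proof.
move=> tn.
rewrite -sum1_card (eq_bigl (fun c : 'I_n => (s <= c < t)%N)) //.
rewrite -(big_mkord (fun c => (s <= c < t)%N) (fun=> 1%N)).
case: (leqP s t) => st; last first.
  by rewrite big1 => [|i]; lia.
rewrite (big_cat_nat (n := s)) ?(leq_trans st tn) //=.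
rewrite big_nat_cond big1 ?add0n; last by move=> i; lia.
rewrite (big_cat_nat (n := t)) //= [X in (_ + X)%N]big_nat_cond.
rewrite [X in (_ + X)%N]big1 ?addn0; last by move=> i; lia.
rewrite big_nat_cond (eq_bigl (fun i => (s <= i < t)%N && true)); last by move=> i; lia.
by rewrite -big_nat_cond sum_nat_const_nat muln1.
Qed.

Lemma card_late (n s : nat) (p : {perm 'I_n}) (A : {set 'I_n}) :
  (forall x, x \in A -> (s <= p^-1%g x)%N) -> (#|A| <= n - s)%N.
Proof.
move=> hA; rewrite -(@card_positions n s n (leqnn n)) -(card_imset (mem A) (@perm_inj _ p^-1%g)).
apply/subset_leq_card/fintype.subsetP => _ /imsetP[x xA ->].
by rewrite inE /= hA //= ltn_ord.
Qed.

Lemma card_free_positions (n s t : nat) (p : {perm 'I_n}) (A : {set 'I_n}) :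
  (t <= n)%N -> (forall x, x \in A -> (s <= p^-1%g x < t)%N) ->
  #|[pred c : 'I_n | (s <= c < t)%N && (p c \notin A)]| = (t - s - #|A|)%N.
Proof.
move=> tn hA.
have sub : [set p^-1%g x | x in A] \subset [pred c : 'I_n | (s <= c < t)%N].
  by apply/fintype.subsetP => _ /imsetP[x xA ->]; rewrite inE /= hA.
rewrite -(card_positions s tn) -(card_imset (mem A) (@perm_inj _ p^-1%g)).
rewrite -[X in (X - _)%N](cardID (mem [set p^-1%g x | x in A])).
rewrite (@eq_card _ [predI _ & mem _] (mem [set p^-1%g x | x in A])); last first.
  by move=> c; rewrite !inE andb_idl // => /(fintype.subsetP sub).
rewrite addKn; apply: eq_card => c; rewrite !inE /= andbC; congr (~~ _ && _).
by rewrite -{2}(permK p c) mem_imset //; apply: perm_inj.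
Qed.

(* Double counting: exchanging the positions of [a] and of the value at position
   [c], and recording the old position of [a], is an involution which exchanges
   the two sets of pairs (p, c) counted by the two sides. *)
Lemma early_swap (n s t : nat) (H : pred {perm 'I_n}) (A : {set 'I_n}) a :
  (forall p (i j : 'I_n), (s <= i)%N -> (s <= j)%N -> H p -> H (tperm i j * p)%g) ->
  (forall p x, H p -> x \in a |: A -> (s <= p^-1%g x)%N) ->
  (t <= n)%N -> a \notin A ->
  (#|[pred p | H p && early t p (a |: A)]| * (n - s - #|A|) =
   #|[pred p | H p && early t p A]| * (t - s - #|A|))%N.
Proof.
move=> Hinv HA tn aA.
pose Phi (z : {perm 'I_n} * 'I_n) := ((tperm (z.1^-1%g a) z.2 * z.1)%g, z.1^-1%g a).
have PhiK : involutive Phi.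
  move=> [p c]; rewrite /Phi /= invMg permM tpermV tpermL.
  by rewrite mulgA tpermC tperm2 mul1g.
have HAs p : H p -> (s <= p^-1%g a)%N by move=> Hp; apply: (HA _ _ Hp); rewrite setU11.
pose Q1 (z : {perm 'I_n} * 'I_n) := (H z.1 && early t z.1 (a |: A)) &&
   ((s <= z.2 < n)%N && (z.1 z.2 \notin A)).
pose Q2 (z : {perm 'I_n} * 'I_n) := (H z.1 && early t z.1 A) &&
   ((s <= z.2 < t)%N && (z.1 z.2 \notin A)).
transitivity (\sum_(z | Q1 z) 1)%N.
  rewrite -(pair_big_dep (fun p => H p && early t p (a |: A))
    (fun (p : {perm 'I_n}) (c : 'I_n) => (s <= c < n)%N && (p c \notin A)) (fun _ _ => 1%N)) /=.
  rewrite -sum1_card big_distrl /=; apply: eq_bigr => p /andP[Hp ep].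
  rewrite mul1n sum1_card -(@card_free_positions n s n p) //.
  by move=> x xA; rewrite ltn_ord andbT (HA _ _ Hp) // setU1r.
transitivity (\sum_(z | Q2 z) 1)%N; last first.
  rewrite -(pair_big_dep (fun p => H p && early t p A)
    (fun (p : {perm 'I_n}) (c : 'I_n) => (s <= c < t)%N && (p c \notin A)) (fun _ _ => 1%N)) /=.
  rewrite -sum1_card big_distrl /=; apply: eq_bigr => p /andP[Hp /forall_inP ep].
  rewrite mul1n sum1_card -(@card_free_positions n s t p) //.
  by move=> x xA; rewrite ep // andbT (HA _ _ Hp) // setU1r.
have moved (p : {perm 'I_n}) (c x : 'I_n) : x \in A -> p c \notin A ->
    (tperm (p^-1%g a) c * p)^-1%g x = p^-1%g x.
  move=> xA pcA; rewrite invMg tpermV permM tpermD //.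
    by apply: contraNneq aA => /perm_inj ->.
  by apply: contraNneq pcA => ->; rewrite permKV.
have Q12 z : Q1 z -> Q2 (Phi z).
  case: z => p c /andP[/andP[/= Hp /forall_inP ep] /andP[/andP[sc _] pcA]].
  apply/andP; split => /=; apply/andP; split.
  - by apply: Hinv => //; apply: HAs.
  - by apply/forall_inP => x xA; rewrite moved // ep // setU1r.
  - by rewrite HAs //= ep // setU11.
  - by rewrite permM tpermL.
have Q21 z : Q2 z -> Q1 (Phi z).
  case: z => p c /andP[/andP[/= Hp /forall_inP ep] /andP[/andP[sc ct] pcA]].
  apply/andP; split => /=; apply/andP; split.
  - by apply: Hinv => //; apply: HAs.
  - apply/forall_inP => x; rewrite !inE => /orP[/eqP->|xA]; last by rewrite moved // ep.
    by rewrite invMg tpermV permM tpermL.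
  - by rewrite HAs // ltn_ord.
  - by rewrite permM tpermL.
rewrite (reindex_inj (inv_inj PhiK)); apply: eq_bigl => z.
by apply/idP/idP => [/Q12|/Q21 //]; rewrite PhiK.
Qed.

(** Think of [H] as a history of the first [s] rounds that leaves [A] unseen. Elements of [A] are
    removed one at a time by [early_swap]; each costs a conditional factor (t-s-m)/(n-s-m), which is
    at most t/n. *)
Lemma early_bound (n s t : nat) (H : pred {perm 'I_n}) (A : {set 'I_n}) :
  (forall p (i j : 'I_n), (s <= i)%N -> (s <= j)%N -> H p -> H (tperm i j * p)%g) ->
  (forall p x, H p -> x \in A -> (s <= p^-1%g x)%N) ->
  (t <= n)%N ->
  (#|[pred p | H p && early t p A]| * n ^ #|A| <= #|H| * t ^ #|A|)%N.
Proof.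
move=> Hinv + tn.
have [m mA] := ubnP #|A|; elim: m A mA => // m IH A mA HA.
have [->|[a aA]] := set_0Vmem A.
  rewrite cards0 !muln1; apply/subset_leq_card/fintype.subsetP => p.
  by rewrite !inE => /andP[].
have eA := finset.setD1K aA.
have cA : #|A| = #|A :\ a|.+1 by rewrite (cardsD1 a A) aA.
have {}IH : (#|[pred p | H p && early t p (A :\ a)]| * n ^ #|A :\ a| <= #|H| * t ^ #|A :\ a|)%N.
  apply: IH; first by rewrite -ltnS -cA.
  by move=> p x Hp /finset.setD1P[_ xA]; apply: HA.
have /= := @early_swap n s t H (A :\ a) a Hinv; rewrite eA => /(_ HA tn).
rewrite !inE eqxx => /(_ isT) E.
rewrite cA !expnS.
set f := #|[pred p | H p && early t p A]| in E *.
set g := #|[pred p | H p && early t p (A :\ a)]| in E IH *.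
set m' := #|A :\ a| in E IH cA *.
have fg : (f * n <= g * t)%N.
  have [->//|f0] := posnP f.
  (* A permutation counted by [f] places all m' + 1 elements of [A] at positions from [s] on, so the
     factor to be cancelled is positive. *)
  have : (0 < n - s - m')%N.
    have /card_gt0P[p] := f0; rewrite inE => /andP[Hp _].
    by have := card_late (fun x => HA p x Hp); rewrite cA; lia.
  move=> npos; rewrite -(leq_pmul2r npos).
  have : (f * (n - s - m') * n <= g * t * (n - s - m'))%N.
    rewrite E -!mulnA leq_mul2l; apply/orP; right.
    (* With c = s + m', the claim is (t - c) n <= t (n - c); when t < c the truncated difference on
       the left is 0. *)
    have [lt|le] := leqP (s + m') t; last by rewrite (_ : t - s - m' = 0)%N; lia.
    by rewrite -!subnDA mulnBl mulnBr leq_sub2l // mulnC leq_mul2l tn orbT.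
  by rewrite mulnAC.
apply: (@leq_trans (g * t * n ^ m')); first by rewrite mulnA leq_mul2r fg orbT.
by rewrite mulnAC [(t * _)%N]mulnC mulnA leq_mul2r IH orbT.
Qed.

(** Telescoping [early_swap] with [s = 0] and no history gives an exact count. The second moment
    needs equality, so that the squared mean cancels in the variance. *)
Lemma card_early (n t : nat) (A : {set 'I_n}) : (t <= n)%N ->
  (#|[pred p : {perm 'I_n} | early t p A]| * n ^_ #|A| = n`! * t ^_ #|A|)%N.
Proof.
move=> tn.
have [m mA] := ubnP #|A|; elim: m A mA => // m IH A mA.
have [->|[a aA]] := set_0Vmem A.
  rewrite cards0 !ffactn0 !muln1 -card_Sn; apply: eq_card => p.
  by rewrite !inE; apply/forall_inP => x; rewrite inE.
have eA := finset.setD1K aA.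
have cA : #|A| = #|A :\ a|.+1 by rewrite (cardsD1 a A) aA.
have {}IH := IH (A :\ a).
have := @early_swap n 0 t predT (A :\ a) a; rewrite eA => /(_ _ _ tn) E.
have {}E : (#|[pred p : {perm 'I_n} | early t p A]| * (n - #|A :\ a|) =
    #|[pred p : {perm 'I_n} | early t p (A :\ a)]| * (t - #|A :\ a|))%N.
  by have := E (fun _ _ _ _ _ _ => isT) (fun _ _ _ _ => isT); rewrite !inE eqxx !subn0 => ->.
rewrite cA !ffactnSr !mulnA mulnAC E mulnAC IH //.
by rewrite -ltnS -cA.
Qed.

(** * Purchases *)

Definition bought (buy : seq nat -> seq bool -> bool) (xs : seq nat) (i : nat) : bool :=
  buy (take i.+1 xs) (decisions buy xs i).

Lemma decisionsE buy xs t : decisions buy xs t = mkseq (bought buy xs) t.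
Proof. by elim: t => //= t IH; rewrite mkseqS -IH. Qed.

Lemma take_decisions buy xs ys s : take s xs = take s ys ->
  decisions buy xs s = decisions buy ys s.
Proof.
elim: s => //= s IH e.
have e' : take s xs = take s ys.
  by rewrite -(take_takel xs (leqnSn s)) e take_takel.
by rewrite IH // e.
Qed.

(** This is the online constraint: it lets positions after round [s] be exchanged without disturbing
    earlier purchases. *)
Lemma bought_take buy xs ys s i : take s xs = take s ys -> (i < s)%N ->
  bought buy xs i = bought buy ys i.
Proof.
move=> e lis.
have te m : (m <= s)%N -> take m xs = take m ys.
  by move=> ms; rewrite -(take_takel xs ms) e take_takel.
by rewrite /bought te // (@take_decisions _ _ ys) // te // ltnW.
Qed.

Lemma purchasedE buy xs t : (t <= size xs)%N ->
  purchased buy xs t = [seq nth 0%N xs i | i <- iota 0 t & bought buy xs i].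
Proof.
move=> tx; rewrite /purchased decisionsE.
have e : xs = map (nth 0%N xs) (iota 0 t) ++ drop t xs.
  by rewrite map_nth_iota0 // cat_take_drop.
rewrite [X in mask _ X]e -[mkseq _ _]cats0 mask_cat; last by rewrite size_mkseq size_map size_iota.
by rewrite mask0s cats0 -map_mask -filter_mask.
Qed.

Lemma size_revealed n (p : {perm 'I_n}) : size (revealed p) = n.
Proof. by rewrite size_map size_enum_ord. Qed.

Lemma nth_revealed n (p : {perm 'I_n}) (i : 'I_n) : nth 0%N (revealed p) i = (p i).+1.
Proof. by rewrite (nth_map i) ?size_enum_ord // nth_ord_enum. Qed.

Lemma take_revealed n (p q : {perm 'I_n}) s :
  (forall i : 'I_n, (i < s)%N -> p i = q i) -> take s (revealed p) = take s (revealed q).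
Proof.
move=> pq; rewrite /revealed -[LHS]map_take -[RHS]map_take; apply/eq_in_map => i.
move=> /(nthP i)[j]; rewrite size_take_min size_enum_ord leq_min => /andP[sj jn] <-.
by rewrite nth_take // (nth_ord_enum i (Ordinal jn)) pq.
Qed.

Lemma mem_purchased n buy (p : {perm 'I_n}) t x : (t <= n)%N ->
  reflect (exists i : 'I_n, [/\ (i < t)%N, bought buy (revealed p) i & x = (p i).+1])
    (x \in purchased buy (revealed p) t).
Proof.
move=> tn; rewrite purchasedE ?size_revealed //.
apply: (iffP mapP) => [[i]|[i [it bi ->]]].
  rewrite mem_filter mem_iota add0n => /andP[bi /andP[_ it]] ->.
  have li := leq_trans it tn; exists (Ordinal li); split => //.
  by rewrite -nth_revealed.
by exists (i : nat); rewrite ?nth_revealed // mem_filter mem_iota bi.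
Qed.

Lemma size_purchased n buy (p : {perm 'I_n}) t : (t <= n)%N ->
  size (purchased buy (revealed p) t) =
  #|[pred i : 'I_n | (i < t)%N && bought buy (revealed p) i]|.
Proof.
move=> tn; rewrite purchasedE ?size_revealed // size_map size_filter.
rewrite -sum1_card -sum1_count.
rewrite -(big_mkord (fun i => (i < t)%N && bought buy (revealed p) i) (fun=> 1%N)).
rewrite (big_cat_nat (n := t)) //= [X in (_ + X)%N]big_nat_cond.
rewrite [X in (_ + X)%N]big1 ?addn0; last by move=> i; lia.
rewrite [in RHS]big_nat_cond [in LHS]big_seq_cond /index_iota subn0 [in RHS]big_seq_cond.
by apply: eq_bigl => i; rewrite mem_iota; lia.
Qed.

(** * Counting the permutations on which a strategy wins *)

(** The predicate [Q] makes it possible to leave out the two terms bought first. Terms not below [n]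
    are silently lost, so counting the set requires a bound on the last term. *)
Definition ap_terms (n k : nat) (Q : pred 'I_k) (a d : nat) : {set 'I_n} :=
  [set x : 'I_n | [exists w, Q w && (x == a + w * d :> nat)%N]]%SET.

Lemma card_ap_terms n k (Q : pred 'I_k) a d : (0 < d)%N -> (a + k.-1 * d < n)%N ->
  #|ap_terms n Q a d| = #|Q|.
Proof.
move=> d0 hn.
have h (w : 'I_k) : (a + w * d < n)%N.
  by apply: leq_ltn_trans hn; rewrite leq_add2l leq_mul2r; have := ltn_ord w; lia.
pose y w := Ordinal (h w).
have yinj : injective y.
  move=> w w' /(congr1 val) /= /addnI /eqP; rewrite eqn_mul2r => /orP[/eqP|/eqP/val_inj//]; lia.
rewrite -(card_imset Q yinj); apply: eq_card => x; rewrite inE.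
apply/existsP/imsetP => [[w /andP[Qw /eqP e]]|[w Qw ->]].
  by exists w => //; apply: val_inj.
by exists w; rewrite eqxx andbT.
Qed.

(** Subtracting the two equations gives (u - v)(d - d') = 0. *)
Lemma ap_unique (u v a d a' d' : nat) : u != v ->
  (a + u * d = a' + u * d')%N -> (a + v * d = a' + v * d')%N -> (a, d) = (a', d').
Proof.
move=> uv e1 e2.
have : (d = d')%N.
  apply/eqP; apply: contraT => dd.
  have : ((u%:Z - v%:Z) * (d%:Z - d'%:Z) = 0)%R by nia.
  by move/eqP; rewrite mulf_eq0 !subr_eq0 /=; lia.
by move=> dd; subst d'; congr (_, _); lia.
Qed.

Section winning.
Variables (n t b k : nat) (buy : seq nat -> seq bool -> bool).
Hypothesis k3 : (3 <= k)%N.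
Hypothesis tn : (t <= n)%N.
Hypothesis budget : forall p : {perm 'I_n}, (size (purchased buy (revealed p) t) <= b)%N.

Local Notation index := ((('I_n * 'I_n) * ('I_k * 'I_k)) * ('I_n * 'I_n))%type.

(* In an index (((a, d), (u, v)), (i, j)), the integers bought in rounds [i < j]
   are the terms number [u] and [v] of the progression a, a + d, a + 2d, etc. *)
Definition completions (z : index) : {set 'I_n} :=
  let: (((a, d), (u, v)), _) := z in
  ap_terms n (fun w => (w != u) && (w != v)) a d.

Definition opening (z : index) (p : {perm 'I_n}) : bool :=
  let: (((a, d), (u, v)), (i, j)) := z in
  [&& (0 < d)%N, (a + k.-1 * d < n)%N, u != v, (i < j < t)%N,
      bought buy (revealed p) i, bought buy (revealed p) j,
      p i == a + u * d :> nat & p j == a + v * d :> nat]%N.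

Definition opening_late (z : index) (p : {perm 'I_n}) : bool :=
  opening z p && [forall x in completions z, z.2.2 < p^-1%g x]%N.

(** The opening is decided by rounds 0 to [j], and the k - 2 completing terms come after round [j],
    so [early_bound] applies with [s = j.+1]. *)
Lemma card_opening_early z :
  (#|[pred p | opening_late z p && early t p (completions z)]| * n ^ (k - 2) <=
   #|opening z| * t ^ (k - 2))%N.
Proof.
case: z => -[[a d] [u v]] [i j].
(* A single permutation with this opening already yields the conditions on [a], [d], [u], [v] that
   fix the number of completions; without one the left side is 0. *)
have [[p /= Op]|no] := pselect (exists p, opening (a, d, (u, v), (i, j)) p); last first.
  rewrite eq_card0 ?mul0n // => p; rewrite !inE; apply/negP => /andP[/andP[Op _] _].
  by apply: no; exists p.
have cA : #|completions (a, d, (u, v), (i, j))| = (k - 2)%N.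
  case/and4P: Op => d0 hn uv _; rewrite /completions card_ap_terms //.
  have := cardC (pred2 u v); rewrite card2 uv card_ord => E.
  transitivity #|[predC pred2 u v]|; last by apply: (@addnI 2); rewrite [LHS]E; lia.
  by apply: eq_card => w; rewrite !inE negb_or.
rewrite -cA.
pose z := (a, d, (u, v), (i, j)).
apply: (@leq_trans (#|opening_late z| * t ^ #|completions z|)).
  apply: (@early_bound n j.+1 t (opening_late _)) => //; last first.
    by move=> q x /andP[_ /forall_inP/(_ x)].
  move=> q i' j' ji jj /andP[Oq /forall_inP late].
  have fixed (x : 'I_n) : (x < j.+1)%N -> (tperm i' j' * q)%g x = q x.
    by move=> xj; rewrite permM tpermD // -val_eqE /=; lia.
  have eb (x : 'I_n) : (x < j.+1)%N ->
      bought buy (revealed (tperm i' j' * q)%g) x = bought buy (revealed q) x.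
    by move=> xj; apply: (@bought_take _ _ _ j.+1) => //; apply: take_revealed.
  apply/andP; split.
    move: Oq => /and4P[h1 h2 h3 /and5P[h4 h5 h6 h7 h8]]; rewrite /opening h1 h2 h3 h4 /=.
    have ij : (i < j)%N by case/andP: h4.
    by rewrite !eb ?fixed ?h5 ?h6 ?h7 // ltnW.
  apply/forall_inP => x xA; have jx := late _ xA.
  rewrite invMg permM tpermV /=.
  by case: tpermP => //; lia.
rewrite leq_mul2r; apply/orP; right; apply/subset_leq_card/fintype.subsetP => q.
by case/andP.
Qed.

(** Take for [u] and [v] the terms of the progression bought first and second; all others then
    appear after round [j] and before round [t]. *)
Lemma winning_opening p : contains_AP k (purchased buy (revealed p) t) ->
  exists z, opening_late z p && early t p (completions z).
Proof.
move=> [a [d [d1 h]]].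
have k0 : (0 < k)%N by lia.
have k1 : (1 < k)%N by lia.
have hw (w : 'I_k) : exists i : 'I_n, [/\ (i < t)%N, bought buy (revealed p) i &
    ((p i).+1)%:Z = a + w%:Z * d]%R.
  by have [x /(mem_purchased _ _ _ tn)[i [it bi ->]] e] := h w (ltn_ord w); exists i.
have [f hf] := choice hw.
(* Permutation values are one below the revealed integers, so [a0] stands for a - 1. *)
have [a0 ea0] : exists a0, a0 = p (f (Ordinal k0)) by eexists.
case: d d1 h hw hf => // d d1 h hw hf.
have ea : a = (a0.+1)%:Z%R by have [_ _] := hf (Ordinal k0); rewrite -ea0 /=; lia.
have ef w : p (f w) = (a0 + w * d)%N :> nat by have [_ _] := hf w; rewrite ea; lia.
(* Term number 1 is a value below [n], so the difference can be encoded in ['I_n]. *)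
have dn : (d < n)%N.
  by have := ef (Ordinal k1); have := ltn_ord (p (f (Ordinal k1))); rewrite /=; lia.
have d0 : (0 < d)%N by lia.
have finj : injective f.
  move=> w w' e; apply: val_inj => /=.
  have : (a0 + w * d = a0 + w' * d)%N by rewrite -!ef e.
  by move=> /addnI /eqP; rewrite eqn_mul2r => /orP[|/eqP//]; lia.
have [u _ umin] := arg_minnP (P := xpredT) (fun w => val (f w)) (i0 := Ordinal k0) isT.
have [w1 w1u] : exists w, w != u.
  case: (eqVneq (Ordinal k0) u) => [<-|]; last by exists (Ordinal k0).
  by exists (Ordinal k1).
have [v vu vmin] := arg_minnP (P := fun w => w != u) (fun w => val (f w)) (i0 := w1) w1u.
exists ((((a0, Ordinal dn), (u, v)), (f u, f v))).
have late x : x \in completions (a0, Ordinal dn, (u, v), (f u, f v)) ->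
    (f v < p^-1%g x)%N && (p^-1%g x < t)%N.
  rewrite inE => /existsP[w /andP[/andP[wu wv] /eqP /= ex]].
  have -> : x = p (f w) by apply: val_inj; rewrite /= ef.
  rewrite permK; have [-> _ _] := hf w; rewrite andbT ltn_neqAle vmin // andbT.
  by rewrite val_eqE (inj_eq finj) eq_sym.
rewrite /opening_late /opening /= d0 !ef !eqxx /= eq_sym vu /=.
have [ut -> _] := hf u; have [vt -> _] := hf v; rewrite vt /= !andbT.
have -> : (f u < f v)%N by rewrite ltn_neqAle umin // andbT val_eqE (inj_eq finj) eq_sym.
rewrite andbT -andbA; apply/and3P; split.
- have kk : (k.-1 < k)%N by lia.
  by rewrite -(ef (Ordinal kk)) ltn_ord.
- by apply/forall_inP => x /late /andP[].
- by apply/forall_inP => x /late /andP[].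
Qed.

(** By [ap_unique], the places [u], [v] and the rounds [i], [j] determine the progression; there are
    at most [k] choices for each place and [b] for each round. *)
Lemma sum_openings p : (\sum_z opening z p <= k ^ 2 * b ^ 2)%N.
Proof.
pose B := [set i : 'I_n | (i < t)%N && bought buy (revealed p) i]%SET.
have cB : (#|B| <= b)%N by rewrite (leq_trans _ (budget p)) // size_purchased // cardsE.
pose F (z : index) := (z.1.2, z.2).
have Finj : {in [pred z | opening z p] &, injective F}.
  move=> [[[a d] uv] ij] [[[a' d'] [u' v']] [i' j']]; rewrite !inE.
  move=> + + [? ?]; subst uv ij => /and4P[_ _ uv /and5P[_ _ _ /eqP e1 /eqP e2]].
  move=> /and4P[_ _ _ /and5P[_ _ _ /eqP e1' /eqP e2']].
  have : u' != v' :> nat by rewrite val_eqE.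
  move=> /ap_unique/(_ (etrans (esym e1) e1') (etrans (esym e2) e2'))[aa dd].
  by rewrite (val_inj aa) (val_inj dd).
have := card_sum_pred [pred z | opening z p] => /= <-.
rewrite -(card_in_imset Finj).
apply: (@leq_trans #|finset.setX [set: 'I_k * 'I_k]%SET (finset.setX B B)|).
  apply/subset_leq_card/fintype.subsetP => _ /imsetP[[[[a d] [u v]] [i j]] /= h ->].
  move: h; rewrite inE => /and4P[_ _ _ /and5P[/andP[ij jt] bi bj _ _]].
  by rewrite !inE /= bi bj jt (ltn_trans ij jt).
by rewrite !cardsX cardsT card_prod card_ord !mulnn leq_mul2l leq_sqr cB orbT.
Qed.

(** A union bound over all indices; the total number of openings is then summed permutation by
    permutation, where [sum_openings] controls it. *)
Lemma card_winning :
  (#|[pred p : {perm 'I_n} | `[< contains_AP k (purchased buy (revealed p) t) >]]| *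
     n ^ (k - 2) <= n`! * (k ^ 2 * b ^ 2) * t ^ (k - 2))%N.
Proof.
pose E z := [pred p | opening_late z p && early t p (completions z)].
apply: (@leq_trans ((\sum_z #|E z|) * n ^ (k - 2))).
  rewrite leq_mul2r; apply/orP; right.
  rewrite -sum1_card; under [leqRHS]eq_bigr do rewrite -sum1_card big_mkcond /=.
  rewrite exchange_big /= [leqLHS]big_mkcond /=; apply: leq_sum => p _; rewrite inE.
  case: asboolP => // /winning_opening[z hz].
  by rewrite (bigD1 z) //= inE [X in if X then _ else _]hz.
rewrite big_distrl /=.
apply: (@leq_trans (\sum_z #|opening z| * t ^ (k - 2))).
  by apply: leq_sum => z _; apply: card_opening_early.
rewrite -big_distrl /= leq_mul2r; apply/orP; right.
under eq_bigr do rewrite -sum1_card big_mkcond /=.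
rewrite exchange_big /= -card_Sn -sum1_card big_distrl /=.
by rewrite big_mkcond /= leq_sum // => p _; rewrite mul1n sum_openings.
Qed.

End winning.

Local Open Scope classical_set_scope.
Local Open Scope ring_scope.

(** * Success probabilities *)

(** Lists of decisions are countable, so an arbitrary [Q] is a countable union of the events that
    fix the list, and these are handled by induction on the rounds. *)
Lemma measurable_decisions (R : realType) n t b (S : strategy R n t b) xs s (Q : seq bool -> Prop) :
  measurable [set w | Q (decisions (buy (s := S) w) xs s)].
Proof.
have m1 ds : measurable [set w | decisions (buy (s := S) w) xs s = ds].
  elim: s ds => [|s IH] ds /=.
    have [->|h] := eqVneq ds [::].
      by rewrite [X in measurable X](_ : _ = setT) //; apply/seteqP.
    rewrite [X in measurable X](_ : _ = set0) //; apply/seteqP; split => // w /=.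
    by move=> e; rewrite -e in h.
  case/lastP: ds => [|ds e].
    rewrite [X in measurable X](_ : _ = set0) //; apply/seteqP; split => // w /=.
    by move/(congr1 size); rewrite size_rcons.
  rewrite [X in measurable X](_ : _ = [set w | decisions (buy (s := S) w) xs s = ds] `&`
    (if e then [set w | buy (s := S) w (take s.+1 xs) ds]
     else ~` [set w | buy (s := S) w (take s.+1 xs) ds])).
    apply: measurableI => //; have := measurable_buy S (take s.+1 xs) ds.
    by case: e => // h; apply: measurableC.
  apply/seteqP; split => w /=.
    by move=> /rcons_inj[<- <-]; split => //; case: ifPn => //= /negP.
  by case=> <-; case: e => /= [->//|/negP/negbTE->].
pose F (o : option (seq bool)) := if o is Some ds then
   (if `[< Q ds >] then [set w | decisions (buy (s := S) w) xs s = ds] else set0) else set0.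
rewrite [X in measurable X](_ : _ = \bigcup_i F (unpickle i)).
  apply: bigcupT_measurable => i; rewrite /F; move: (unpickle i) => [ds|//].
  by case: asboolP.
apply/seteqP; split => w.
  move=> h; exists (pickle (decisions (buy (s := S) w) xs s)) => //.
  by rewrite pickleK /F; case: asboolP.
by move=> [i _]; rewrite /F; move: (unpickle i) => [ds|//]; case: asboolP => //= Qds ->.
Qed.

(** Reduction to deterministic strategies: exchanging the sum over permutations with the integral
    over seeds makes the success probability an average of the winning proportions for fixed
    seeds. *)
Lemma success_probability_le (R : realType) n t b k (S : strategy R n t b) (M : R) :
  (forall w : seed S, #|[pred p : {perm 'I_n} |
     `[< contains_AP k (purchased (buy (s := S) w) (revealed p) t) >]]|%:R <= M) ->
  success_probability S k <= M / n`!%:R.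
Proof.
move=> hM; rewrite /success_probability ler_pM2r ?invr_gt0 ?ltr0n ?fact_gt0 //.
pose A (p : {perm 'I_n}) := [set w | contains_AP k (purchased (buy (s := S) w) (revealed p) t)].
have mA p : measurable (A p).
  exact: (@measurable_decisions _ _ _ _ S (revealed p) t
    (fun ds => contains_AP k (mask ds (revealed p)))).
rewrite -lee_fin -sumEFin.
rewrite (eq_bigr (fun p => seed_law S (A p))); last first.
  by move=> p _; rewrite fineK //; exact: (fin_num_measure (seed_law S) _ (mA p)).
have -> : (\sum_p seed_law S (A p) = \sum_p \int[seed_law S]_w (\1_(A p) w)%:E)%E.
  by apply: eq_bigr => p _; rewrite integral_indic // setIT.
rewrite -ge0_integral_sum //; last first.
  by move=> p; apply/measurable_EFinP; apply: measurable_indic.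
have -> : M%:E = (\int[seed_law S]_w (cst M%:E) w)%E.
  rewrite (integral_cst (seed_law S) measurableT) -[LHS]mule1; congr (_ * _)%E.
  by apply/esym; exact: probability_setT.
apply: ge0_le_integral => //.
- by move=> w _; apply: sume_ge0 => p _; rewrite lee_fin.
- by apply: emeasurable_sum => p; apply/measurable_EFinP; apply: measurable_indic.
move=> w _; rewrite sumEFin lee_fin (le_trans _ (hM w)) //.
rewrite -sum1_card natr_sum [leRHS]big_mkcond /=; apply: ler_sum => p _.
rewrite inE indicE (_ : (w \in A p) = `[< A p w >]); first by case: asboolP.
by apply/idP/asboolP => [/set_mem|/mem_set].
Qed.

Lemma success_probability_ge0 (R : realType) n t b k (S : strategy R n t b) :
  0 <= success_probability S k.
Proof. by apply: divr_ge0 => //; apply: sumr_ge0 => p _; apply: fine_ge0. Qed.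

Lemma success_probability_bound (R : realType) n t b k (S : strategy R n t b) :
  (3 <= k)%N -> (1 <= n)%N -> (t <= n)%N ->
  success_probability S k <= k%:R ^+ 2 * (b%:R ^+ 2 * (t%:R / n%:R) ^+ (k - 2)).
Proof.
move=> k3 n1 tn.
pose M : R := (n`!)%:R * (k%:R ^+ 2 * (b%:R ^+ 2 * (t%:R / n%:R) ^+ (k - 2))).
have f0 : (0 : R) < n`!%:R by rewrite ltr0n fact_gt0.
have n0 : (0 : R) < n%:R ^+ (k - 2) by rewrite exprn_gt0 // ltr0n.
rewrite (le_trans (@success_probability_le _ _ _ _ k S M _)) //; last first.
  by rewrite /M mulrAC divff ?gt_eqF // mul1r.
move=> w; have := card_winning k3 tn (fun p => budget (s := S) w p).
rewrite -(ler_nat R) !natrM !natrX => h.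
rewrite /M expr_div_n !mulrA ler_pdivlMr //.
by rewrite (le_trans h) // !mulrA.
Qed.

(** * Impossibility *)

Lemma cvg_exprn (R : realType) (u : nat -> R) (l : R) (m : nat) :
  u n @[n --> \oo] --> l -> u n ^+ m @[n --> \oo] --> l ^+ m.
Proof. by move=> ul; exact: (continuous_cvg _ (@exprn_continuous R m l) ul). Qed.

(** Squaring clears the real exponent and turns the ratio from the budget hypothesis into the
    quantity bounding the success probability. *)
Lemma sqr_budget_ratio (R : realType) (n t b k : nat) : (3 <= k)%N -> (1 <= t)%N -> (1 <= n)%N ->
  (b%:R / (n%:R / t%:R) `^ ((k%:R - 2) / 2)) ^+ 2 = b%:R ^+ 2 * (t%:R / n%:R) ^+ (k - 2) :> R.
Proof.
move=> k3 t1 n1; rewrite expr_div_n; congr (_ * _).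
rewrite -powR_mulrn ?powR_ge0 // -powRrM -mulrA mulVf // mulr1.
rewrite -(natrB _ (ltnW k3)) powR_mulrn ?divr_ge0 //.
by rewrite -exprVn invf_div.
Qed.

(** Since b <= t, the right side dominates b^2 (t/n)^(k-2), which reduces the case of small [t] to
    the same bound. *)
Lemma expr_time_ratio (R : realType) (n t k : nat) : (3 <= k)%N -> (1 <= n)%N ->
  (t%:R / n%:R `^ (1 - 2 / k%:R)) ^+ k = t%:R ^+ 2 * (t%:R / n%:R) ^+ (k - 2) :> R.
Proof.
move=> k3 n1; rewrite expr_div_n -[(_ `^ _) ^+ k]powR_mulrn ?powR_ge0 // -powRrM.
rewrite mulrBl mul1r divfK ?pnatr_eq0; last by case: k k3.
rewrite -(natrB _ (ltnW k3)) powR_mulrn // expr_div_n mulrA -exprD subnKC //.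
exact: ltnW.
Qed.

Lemma success_probability_cvg0 (R : realType) (k : nat) (t b : nat -> nat) :
  (3 <= k)%N ->
  (forall n, (1 <= n)%N -> [/\ (1 <= t n)%N, (b n <= t n)%N & (t n <= n)%N]) ->
  little_o (fun n => (t n)%:R : R) (fun n => n%:R `^ (1 - 2 / k%:R)) \/
  little_o (fun n => (b n)%:R : R) (fun n => (n%:R / (t n)%:R) `^ ((k%:R - 2) / 2)) ->
  forall S : forall n, strategy R n (t n) (b n),
    success_probability (S n) k @[n --> \oo] --> (0 : R).
Proof.
move=> k3 htb small S.
(* The sequence [v] is the [k]-th power of the time ratio in the first case and the square of the
   budget ratio in the second. *)
have [v v0 bound] : exists2 v : nat -> R, v n @[n --> \oo] --> (0 : R) &
    forall n, (1 <= n)%N -> (b n)%:R ^+ 2 * ((t n)%:R / n%:R) ^+ (k - 2) <= v n.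
  case: small => [/(@cvg_exprn _ _ _ k) | /(@cvg_exprn _ _ _ 2)]; rewrite expr0n.
    rewrite gtn_eqF ?(ltn_trans _ k3) // => h; eexists; first exact: h.
    move=> n n1 /=; have [t1 bt tn] := htb n n1; rewrite expr_time_ratio //.
    by rewrite ler_wpM2r ?exprn_ge0 ?divr_ge0 // lerXn2r ?nnegrE // ler_nat.
  move=> h; eexists; first exact: h.
  by move=> n n1 /=; have [t1 bt tn] := htb n n1; rewrite sqr_budget_ratio.
apply: (squeeze_cvgr (f := fun=> 0) (h := fun n => k%:R ^+ 2 * v n)).
- exists 1%N => // n /= n1; rewrite success_probability_ge0 /=.
  have [t1 bt tn] := htb n n1.
  by rewrite (le_trans (success_probability_bound _ k3 n1 tn)) // ler_wpM2l ?exprn_ge0 // bound.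
- exact: cvg_cst.
- by rewrite -[X in _ --> X](mulr0 (k%:R ^+ 2)); apply: cvgM => //; exact: cvg_cst.
Qed.

(** * Second moments *)

Section second_moment.
Variables (R : realType) (n t : nat).
Hypotheses (n0 : (0 < n)%N) (tn : (t <= n)%N).

(** For m <= n, the probability that [m] given values all appear in the first [t] rounds. *)
Definition early_prob (m : nat) : R := (t ^_ m)%:R / (n ^_ m)%:R.
Local Notation q := early_prob.
Local Notation p := (t%:R / n%:R : R).

Lemma early_probE (A : {set 'I_n}) :
  #|[pred s : {perm 'I_n} | early t s A]|%:R = n`!%:R * q #|A|.
Proof.
have An : (#|A| <= n)%N by rewrite -[X in (_ <= X)%N]card_ord max_card.
rewrite /q mulrA -natrM -card_early // natrM mulfK //.
by rewrite pnatr_eq0 -lt0n ffact_gt0.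
Qed.

Lemma early_prob_ge0 m : 0 <= q m.
Proof. by rewrite divr_ge0. Qed.

Lemma early_probS m : q m.+1 = q m * ((t - m)%:R / (n - m)%:R).
Proof. by rewrite /q !ffactnSr !natrM invfM; ring. Qed.

Lemma early_ratio_le i j : (i <= j)%N ->
  (t - j)%:R / (n - j)%:R <= (t - i)%:R / (n - i)%:R :> R.
Proof.
(* For j >= n the left denominator is 0, and the quotient is 0 by convention. *)
move=> ij; have [nj|jn] := leqP n j.
  by rewrite (_ : n - j = 0)%N ?invr0 ?mulr0 ?divr_ge0 //; lia.
have d0 m : (m < n)%N -> (0 : R) < (n - m)%:R by rewrite ltr0n subn_gt0.
rewrite ler_pdivrMr ?d0 // mulrAC ler_pdivlMr ?d0 ?(leq_ltn_trans ij) //.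
rewrite -!natrM ler_nat.
have [tj|jt] := leqP t j; first by rewrite (_ : t - j = 0)%N //; lia.
have [i' ei] : exists i', j = (i + i')%N by exists (j - i)%N; lia.
have [t' et] : exists t', t = (j + t')%N by exists (t - j)%N; lia.
have [n' en] : exists n', n = (t + n')%N by exists (n - t)%N; lia.
rewrite (_ : t - j = t')%N; last lia.
rewrite (_ : n - j = t' + n')%N; last lia.
rewrite (_ : t - i = i' + t')%N; last lia.
rewrite (_ : n - i = i' + t' + n')%N; last lia.
by nia.
Qed.

(** The successive factors (t - i)/(n - i) decrease with [i]. This negative correlation lets
    disjoint sets contribute nothing to the variance bounds. *)
Lemma early_prob_add l m : q (l + m) <= q l * q m.
Proof.
elim: m => [|m IH]; first by rewrite addn0 {3}/q !ffactn0 divr1 mulr1.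
rewrite addnS !early_probS mulrA.
apply: ler_pM => //; rewrite ?early_prob_ge0 ?divr_ge0 //.
by apply: early_ratio_le; rewrite leq_addl.
Qed.

Lemma early_prob1 : q 1 = p. Proof. by rewrite /q !ffactn1. Qed.

Lemma early_prob_le_exp m : q m <= p ^+ m.
Proof.
elim: m => [|m IH]; first by rewrite /q !ffactn0 divr1.
by rewrite -addn1 (le_trans (early_prob_add _ _)) // addn1 exprSr early_prob1 ler_wpM2r // divr_ge0.
Qed.

(** For i < m the numerator t - i is at least t/2, while n - i is at most n. *)
Lemma early_prob_ge_exp m : (2 * m <= t)%N -> (p / 2) ^+ m <= q m.
Proof.
elim: m => [|m IH] mt; first by rewrite /q !ffactn0 divr1.
rewrite early_probS exprSr ler_pM ?exprn_ge0 ?divr_ge0 ?IH //; first lia.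
have np : (0 : R) < n%:R by rewrite ltr0n.
have nm : (0 : R) < (n - m)%:R by rewrite ltr0n; lia.
rewrite -mulrA -invfM ler_pdivrMr ?mulr_gt0 // mulrAC ler_pdivlMr //.
by rewrite -!natrM ler_nat; nia.
Qed.

Lemma time_ratio_le1 : p <= 1.
Proof. by rewrite ler_pdivrMr ?ltr0n // mul1r ler_nat. Qed.

Lemma early_prob_anti l m : (l <= m)%N -> q m <= q l.
Proof.
move=> lm; rewrite -(subnKC lm) (le_trans (early_prob_add _ _)) //.
rewrite -[leRHS]mulr1 ler_wpM2l ?early_prob_ge0 // (le_trans (early_prob_le_exp _)) //.
by rewrite exprn_ile1 ?divr_ge0 ?time_ratio_le1.
Qed.

Variables (I : finType) (A : I -> {set 'I_n}).

Definition num_early (s : {perm 'I_n}) : R := \sum_i (early t s (A i))%:R.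

Lemma sum_num_early : \sum_s num_early s = n`!%:R * \sum_i q #|A i|.
Proof.
rewrite /num_early exchange_big mulr_sumr; apply: eq_bigr => i _ /=.
by rewrite -early_probE card_sum_pred natr_sum.
Qed.

Lemma sum_num_early_sqr :
  \sum_s num_early s ^+ 2 = n`!%:R * \sum_i \sum_j q #|A i :|: A j|.
Proof.
rewrite /num_early; under eq_bigr => s _.
  rewrite expr2 big_distrlr /=; under eq_bigr do under eq_bigr do rewrite -natrM mulnb.
  over.
rewrite exchange_big mulr_sumr; apply: eq_bigr => i _ /=.
rewrite exchange_big mulr_sumr; apply: eq_bigr => j _ /=.
rewrite -early_probE -sum1_card natr_sum [RHS]big_mkcond; apply: eq_bigr => s _.
rewrite inE; have -> : early t s (A i :|: A j) = early t s (A i) && early t s (A j).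
  apply/forall_inP/andP => [h|[/forall_inP h1 /forall_inP h2] x].
    by split; apply/forall_inP => x xA; apply: h; rewrite inE xA ?orbT.
  by rewrite inE => /orP[/h1|/h2].
by case: early; case: early.
Qed.

(** Chebyshev's inequality, with [V] an upper bound for the variance and expectations written as
    sums over the n! permutations. *)
Lemma chebyshev_early (mu V lam : R) (B : pred {perm 'I_n}) :
  \sum_i q #|A i| = mu ->
  \sum_i \sum_j q #|A i :|: A j| <= mu ^+ 2 + V ->
  0 < lam ->
  (forall s, B s -> lam ^+ 2 <= (num_early s - mu) ^+ 2) ->
  #|B|%:R / n`!%:R <= V / lam ^+ 2.
Proof.
move=> hmu hV lam0 hB.
rewrite ler_pdivrMr ?ltr0n ?fact_gt0 // mulrAC ler_pdivlMr ?exprn_gt0 //.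
apply: (@le_trans _ _ (\sum_s (num_early s - mu) ^+ 2)).
  rewrite -sum1_card natr_sum mulr_suml big_mkcond; apply: ler_sum => s _.
  by case: ifP => [/hB|_]; rewrite ?mul1r ?sqr_ge0.
have -> : \sum_s (num_early s - mu) ^+ 2 =
    \sum_s num_early s ^+ 2 - (2 * mu) * \sum_s num_early s + n`!%:R * mu ^+ 2.
  rewrite mulr_sumr -sumrB -[n`!%:R](_ : #|{perm 'I_n}|%:R = _); last by rewrite card_Sn.
  by rewrite -sum1_card natr_sum mulr_suml -big_split; apply: eq_bigr => s _ /=; ring.
rewrite sum_num_early_sqr sum_num_early hmu.
rewrite -[leLHS](_ : n`!%:R * (\sum_i \sum_j q #|A i :|: A j| - mu ^+ 2) = _); last by ring.
by rewrite mulrC ler_wpM2r // lerBlDl.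
Qed.

End second_moment.

(** Chebyshev for singletons: the mean [mu] is at most b/2, so exceeding [b] is a deviation of at
    least b/2. The variance is at most [mu], and (b/2)/(b/2)^2 = 2/b. *)
Lemma many_small_early (R : realType) n t N b :
  (0 < n)%N -> (t <= n)%N -> (N <= n)%N -> (0 < b)%N ->
  N%:R * (t%:R / n%:R) <= b%:R / 2 :> R ->
  #|[pred s : {perm 'I_n} | (b < #|[pred x : 'I_n | (x < N)%N && (s^-1%g x < t)%N]|)%N]|%:R / n`!%:R
    <= 2 / b%:R :> R.
Proof.
move=> n0 tn Nn b0 hb.
pose A (i : 'I_N) : {set 'I_n} := [set widen_ord Nn i]%SET.
pose mu : R := N%:R * (t%:R / n%:R).
have bR : (0 : R) < b%:R by rewrite ltr0n.
have mu0 : 0 <= mu by rewrite mulr_ge0 // divr_ge0.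
have q1 : early_prob R n t 1 = t%:R / n%:R by exact: early_prob1.
have hmu : \sum_i early_prob R n t #|A i| = mu.
  under eq_bigr do rewrite cards1 q1.
  by rewrite sumr_const card_ord -[LHS]mulr_natl.
have hV : \sum_i \sum_j early_prob R n t #|A i :|: A j| <= mu ^+ 2 + mu.
  rewrite (_ : mu ^+ 2 + mu = \sum_(i < N) (N%:R * (t%:R / n%:R) ^+ 2 + t%:R / n%:R)); last first.
    by rewrite sumr_const card_ord -[RHS]mulr_natl /mu; ring.
  (* The diagonal pair contributes t/n, every other pair at most (t/n)^2. *)
  apply: ler_sum => i _; rewrite (bigD1 i) //= finset.setUid cards1 q1 addrC lerD2r.
  rewrite (_ : N%:R * (t%:R / n%:R) ^+ 2 = \sum_(j < N) (t%:R / n%:R) ^+ 2); last first.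
    by rewrite sumr_const card_ord -[RHS]mulr_natl.
  rewrite big_mkcond; apply: ler_sum => j _; case: ifP => ji; last by rewrite exprn_ge0 ?divr_ge0.
  by rewrite cards2 -val_eqE /= val_eqE eq_sym ji /= early_prob_le_exp.
have := @chebyshev_early R n t tn _ A mu mu (b%:R / 2)
  [pred s : {perm 'I_n} | (b < #|[pred x : 'I_n | (x < N)%N && (s^-1%g x < t)%N]|)%N] hmu hV.
move=> /(_ _ _)/le_trans; apply.
- by rewrite divr_gt0.
- move=> s /= hs.
  have -> : num_early R t A s = #|[pred x : 'I_n | (x < N)%N && (s^-1%g x < t)%N]|%:R.
    rewrite -sum1_card natr_sum big_mkcondr /= (big_ord_narrow Nn).
    apply: eq_bigr => i _; rewrite -(_ : (s^-1%g (widen_ord Nn i) < t)%N = early t s (A i)).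
      by case: ltnP.
    by apply/idP/forall_inP => [h x|]; [rewrite inE => /eqP-> | apply; rewrite inE].
  rewrite lerXn2r ?nnegrE ?divr_ge0 //.
    rewrite subr_ge0 (le_trans hb) // (le_trans _ (ltW (_ : b%:R < _))) ?ltr_nat //.
    by rewrite ler_pdivrMr // ler_peMr //; lra.
  by move: hs; rewrite -(ltr_nat R); rewrite -/mu in hb; lra.
- rewrite ler_pdivrMr ?exprn_gt0 ?divr_gt0 // (le_trans hb) //.
  by rewrite le_eqVlt; apply/orP; left; apply/eqP; field; rewrite gt_eqF.
Qed.

(** * Progressions of an interval that are revealed early *)

Lemma sum_unique_le1 (T : finType) (P : pred T) :
  (forall x y, P x -> P y -> x = y) -> (\sum_x P x <= 1)%N.
Proof.
by move=> Pu; rewrite -card_sum_pred; apply/card_le1_eqP => x y Px Py; apply: Pu.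
Qed.

Lemma last_term_lt k L (i : 'I_L * 'I_L) : (2 <= k)%N ->
  (i.1 + k.-1 * i.2.+1 < k * L)%N.
Proof. by move=> k2; have := ltn_ord i.1; have := ltn_ord i.2; nia. Qed.

Section ap_count.
Variables (R : realType) (n t k L : nat).
Hypotheses (n0 : (0 < n)%N) (tn : (t <= n)%N) (Ln : (k * L <= n)%N) (k2 : (2 <= k)%N).

Local Notation I := ('I_L * 'I_L)%type.
Local Notation p := (t%:R / n%:R : R).
Local Notation q := (early_prob R n t).

(** The second coordinate is shifted to make the difference positive; by [last_term_lt] all terms
    lie below [k * L]. *)
Definition ap_of (i : I) : {set 'I_n} := ap_terms n (fun _ : 'I_k => true) i.1 i.2.+1.

Lemma card_ap_of i : #|ap_of i| = k.
Proof.
rewrite card_ap_terms // ?(leq_trans (last_term_lt i k2)) //.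
by rewrite -[RHS]card_ord; apply: eq_card.
Qed.

Definition meet_at (i j : I) (u v : 'I_k) : bool :=
  (i.1 + u * i.2.+1 == j.1 + v * j.2.+1)%N.

Lemma mem_ap_ofI i j x : x \in ap_of i :&: ap_of j ->
  exists u v : 'I_k, [/\ x = i.1 + u * i.2.+1 :> nat, x = j.1 + v * j.2.+1 :> nat
    & meet_at i j u v]%N.
Proof.
rewrite !inE => /andP[/existsP[u /andP[_ /eqP eu]] /existsP[v /andP[_ /eqP ev]]].
by exists u, v; split => //; rewrite /meet_at -eu -ev.
Qed.

(* The three terms account for the pairs sharing no, exactly one, and at least two
   elements. *)
Lemma ap_pair_bound i j :
  q #|ap_of i :|: ap_of j| <= q k ^+ 2
    + p ^+ (2 * k - 1) * (\sum_u \sum_v meet_at i j u v)%:R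
    + p ^+ k * (\sum_(z : ('I_k * 'I_k) * ('I_k * 'I_k)) 
         [&& z.2.1 != z.2.2, meet_at i j z.1.1 z.2.1 & meet_at i j z.1.2 z.2.2])%:R.
Proof.
have p0 : 0 <= p by rewrite divr_ge0.
have cU := cardsUI (ap_of i) (ap_of j); rewrite !card_ap_of in cU.
have [c0|] := posnP #|ap_of i :&: ap_of j|.
  rewrite c0 addn0 in cU; rewrite cU -addrA ler_wpDr ?addr_ge0 ?mulr_ge0 ?exprn_ge0 //.
  by rewrite expr2 early_prob_add.
rewrite leq_eqVlt => /orP[/eqP c1|c2].
  have /card_gt0P[x /mem_ap_ofI[u [v [_ _ uv]]]] : (0 < #|ap_of i :&: ap_of j|)%N by rewrite -c1.
  rewrite -addrA addrCA ler_wpDr ?addr_ge0 ?sqr_ge0 ?mulr_ge0 ?exprn_ge0 //.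
  rewrite (le_trans (early_prob_le_exp _ _ _ _)) //.
  rewrite (_ : #|_| = 2 * k - 1)%N; last by lia.
  rewrite ler_peMr ?exprn_ge0 // ler1n lt0n sum_nat_eq0 negb_forall.
  apply/existsP; exists u; rewrite /= sum_nat_eq0 negb_forall.
  by apply/existsP; exists v; rewrite uv.
rewrite [leRHS]addrC ler_wpDr ?addr_ge0 ?sqr_ge0 ?mulr_ge0 ?exprn_ge0 //.
(* With two or more shared elements, only the [k] values of one progression are counted in the
   union. *)
apply: (@le_trans _ _ (p ^+ k)).
  rewrite (le_trans (early_prob_anti _ _ _ (_ : k <= _)%N)) ?early_prob_le_exp //.
  by rewrite -{1}(card_ap_of i) subset_leq_card // finset.subsetUl.
rewrite ler_peMr ?exprn_ge0 // ler1n.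
have [x [y [xI yI xy]]] : exists x y,
    [/\ x \in ap_of i :&: ap_of j, y \in ap_of i :&: ap_of j & x != y].
  have /card_gt0P[x xI] : (0 < #|ap_of i :&: ap_of j|)%N by apply: ltn_trans c2.
  move: c2; rewrite (cardsD1 x) xI ltnS => /card_gt0P[y /finset.setD1P[yx yI]].
  by exists x, y; split => //; rewrite eq_sym.
have [u [v [_ ex m1]]] := mem_ap_ofI xI; have [u' [v' [_ ey m2]]] := mem_ap_ofI yI.
rewrite lt0n sum_nat_eq0 negb_forall; apply/existsP; exists ((u, u'), (v, v')).
rewrite /= m1 m2 !andbT eqb0 negbK; apply: contraNneq xy => vv.
by apply/eqP/val_inj; rewrite /= ex ey vv.
Qed.

(** There are L^2 choices of [i], k^2 of the places and [L] of the difference of [j]; the start of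
    [j] is then forced. *)
Lemma count_meet :
  (\sum_i \sum_j \sum_u \sum_v meet_at i j u v <= k ^ 2 * L ^ 3)%N.
Proof.
have inner i u v : (\sum_j meet_at i j u v <= L)%N.
  rewrite -(pair_bigA _ (fun a d : 'I_L => nat_of_bool (meet_at i (a, d) u v))) /= exchange_big /=.
  rewrite -[leqRHS]muln1 -[X in (_ <= X * _)%N]card_ord -sum_nat_const; apply: leq_sum => d _.
  apply: sum_unique_le1 => a a' /eqP ea /eqP ea'.
  by apply: val_inj; rewrite /= in ea ea' *; lia.
apply: (@leq_trans (\sum_(i : I) \sum_(u < k) \sum_(v < k) L)).
  apply: leq_sum => i _; rewrite exchange_big /=; apply: leq_sum => u _.
  by rewrite exchange_big /=; apply: leq_sum => v _.
by rewrite !sum_nat_const card_prod !card_ord; lia.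
Qed.

(** Two meetings at distinct places of [j] determine [j] by [ap_unique], leaving free only [i] and
    the four places. *)
Lemma count_meet_twice :
  (\sum_i \sum_j \sum_(z : ('I_k * 'I_k) * ('I_k * 'I_k))
     [&& z.2.1 != z.2.2, meet_at i j z.1.1 z.2.1 & meet_at i j z.1.2 z.2.2] <= k ^ 4 * L ^ 2)%N.
Proof.
apply: (@leq_trans (\sum_(i : I) \sum_(z : ('I_k * 'I_k) * ('I_k * 'I_k)) 1)).
  apply: leq_sum => i _; rewrite exchange_big /=; apply: leq_sum => z _.
  apply: sum_unique_le1 => -[a d] [a' d'] /and3P[vv /eqP e1 /eqP e2] /and3P[_ /eqP e1' /eqP e2'].
  by have [/val_inj -> /val_inj ->] :=
    ap_unique vv (etrans (esym e1) e1') (etrans (esym e2) e2').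
by rewrite !sum_nat_const !card_prod !card_ord; lia.
Qed.

(** Without an early progression the count is 0, a deviation by the whole mean [mu]. With p = t/n,
    the mean is at least L^2 (p/2)^k, whose square produces 4^k, and [V] collects the pairs that
    meet. *)
Lemma no_ap_early : (2 * k <= t)%N -> (0 < L)%N ->
  #|[pred s : {perm 'I_n} | [forall i, ~~ early t s (ap_of i)]]|%:R / n`!%:R
    <= 4 ^+ k * (k%:R ^+ 2 / (L%:R * p) + k%:R ^+ 4 / (L%:R ^+ 2 * p ^+ k)).
Proof.
move=> kt L0.
have t0 : (0 < t)%N by lia.
have p0 : 0 < p by rewrite divr_gt0 // ltr0n.
have p0W : 0 <= p := ltW p0.
have LR : (0 : R) < L%:R by rewrite ltr0n.
pose mu : R := L%:R ^+ 2 * q k.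
pose V : R := p ^+ (2 * k - 1) * (k ^ 2 * L ^ 3)%:R + p ^+ k * (k ^ 4 * L ^ 2)%:R.
have mu_ge : L%:R ^+ 2 * (p / 2) ^+ k <= mu.
  by rewrite ler_wpM2l ?exprn_ge0 ?early_prob_ge_exp.
have mu0 : 0 < mu by rewrite (lt_le_trans _ mu_ge) // mulr_gt0 ?exprn_gt0 // divr_gt0.
have hmu : \sum_i q #|ap_of i| = mu.
  under eq_bigr do rewrite card_ap_of.
  by rewrite sumr_const card_prod card_ord -[LHS]mulr_natl natrM /mu expr2.
have hV : \sum_i \sum_j q #|ap_of i :|: ap_of j| <= mu ^+ 2 + V.
  apply: (le_trans (ler_sum _ (fun i _ => ler_sum _ (fun j _ => ap_pair_bound i j)))).
  have [Q eQ] : exists Q, Q = q k ^+ 2 by eexists.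
  have -> : mu ^+ 2 = (L * L * (L * L))%:R * Q by rewrite /mu eQ !natrM; ring.
  rewrite -eQ; under eq_bigr do rewrite !big_split /= -!mulr_sumr -!natr_sum.
  rewrite !big_split /= -!mulr_sumr -!natr_sum /V addrA.
  apply: lerD; last by rewrite ler_wpM2l ?exprn_ge0 // ler_nat count_meet_twice.
  apply: lerD; last by rewrite ler_wpM2l ?exprn_ge0 // ler_nat count_meet.
  by rewrite !sumr_const card_prod card_ord -mulrnA -[leLHS]mulr_natl.
have := @chebyshev_early R n t tn _ ap_of mu V mu
  [pred s : {perm 'I_n} | [forall i, ~~ early t s (ap_of i)]] hmu hV mu0.
move=> /(_ _)/le_trans; apply.
  move=> s /= /forallP h; rewrite /num_early big1 ?sub0r ?sqrrN // => i _.
  by rewrite (negbTE (h i)).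
have m0 : 0 < L%:R ^+ 2 * (p / 2) ^+ k by rewrite mulr_gt0 ?exprn_gt0 // divr_gt0.
apply: (@le_trans _ _ (V / (L%:R ^+ 2 * (p / 2) ^+ k) ^+ 2)).
  have V0 : 0 <= V by rewrite addr_ge0 // mulr_ge0 // exprn_ge0.
  rewrite ler_wpM2l // lef_pV2 ?posrE ?exprn_gt0 //.
  by rewrite lerXn2r // nnegrE ltW.
rewrite le_eqVlt; apply/orP; left; apply/eqP; rewrite /V (natrM _ (k ^ 2)) (natrM _ (k ^ 4)) !natrX.
have -> : p ^+ (2 * k - 1) = p ^+ k * p ^+ k / p.
  rewrite -exprD (_ : k + k = (2 * k - 1).+1)%N; last by lia.
  by rewrite exprS mulrAC divff ?gt_eqF // mul1r.
rewrite [(p / 2) ^+ k]expr_div_n.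
have -> : 4 ^+ k = (2 ^+ k) ^+ 2 :> R by rewrite -exprM mulnC exprM; congr (_ ^+ k); ring.
have : p ^+ k != 0 by rewrite expf_neq0 ?gt_eqF.
have : (2 : R) ^+ k != 0 by rewrite expf_neq0.
move: (p ^+ k) (2 ^+ k) => P T T0 P0.
have pn : p != 0 by rewrite gt_eqF.
have Ln0 : L%:R != 0 :> R by rewrite gt_eqF.
by move: p pn => x x0; field; rewrite T0 P0 x0 Ln0.
Qed.

End ap_count.

(** * Buying an interval *)

(** The last entry of [xs] is the integer just revealed; the second test enforces the budget on
    every permutation. *)
Definition buy_small (N b : nat) (xs : seq nat) (ds : seq bool) : bool :=
  (last 0 xs <= N)%N && (count id ds < b)%N.

Lemma size_mask_count (T : Type) (m : seq bool) (s : seq T) : (size (mask m s) <= count id m)%N.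
Proof. by elim: m s => [|[] m IH] [|x s] //=; rewrite ?add1n ?add0n ?ltnS. Qed.

Lemma count_decisions_buy_small N b xs s : (count id (decisions (buy_small N b) xs s) <= b)%N.
Proof.
elim: s => //= s IH; rewrite -cats1 count_cat /= addn0 {2}/buy_small.
by case: ltnP => h; rewrite ?andbF ?addn0 //; case: (_ <= N)%N; lia.
Qed.

(** Earlier purchases are early small values different from the current one, which is also early and
    small. Hence there are fewer than [b] of them and the budget test passes. *)
Lemma bought_buy_small n t N b (p : {perm 'I_n}) (i : 'I_n) :
  (#|[pred x : 'I_n | (x < N)%N && (p^-1%g x < t)%N]| <= b)%N ->
  (i < t)%N -> (p i < N)%N -> bought (buy_small N b) (revealed p) i.
Proof.
move=> Yb it piN; apply/andP; split.
  by rewrite (take_nth 0%N) ?size_revealed ?ltn_ord // last_rcons nth_revealed.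
rewrite decisionsE count_map.
have -> : count (preim (bought (buy_small N b) (revealed p)) id) (iota 0 i) =
    size (purchased (buy_small N b) (revealed p) i).
  by rewrite purchasedE ?size_revealed ?(ltnW (ltn_ord i)) // size_map size_filter.
rewrite size_purchased ?(ltnW (ltn_ord i)) //; apply: leq_trans Yb.
rewrite -(card_imset _ (@perm_inj _ p)); apply: proper_card.
apply/properP; split.
  apply/fintype.subsetP => _ /imsetP[j jB ->]; move: jB; rewrite inE => /andP[ji /andP[jN _]].
  rewrite inE /= permK (ltn_trans ji it) andbT.
  by move: jN; rewrite (take_nth 0%N) ?size_revealed ?ltn_ord // last_rcons nth_revealed.
exists (p i); first by rewrite inE /= permK piN.
apply/imsetP => -[j jB /perm_inj ij].
by move: jB; rewrite -ij inE ltnn.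
Qed.

Lemma buy_small_wins n t N b k L (p : {perm 'I_n}) :
  (t <= n)%N -> (k * L <= N)%N -> (N <= n)%N -> (2 <= k)%N ->
  (#|[pred x : 'I_n | (x < N)%N && (p^-1%g x < t)%N]| <= b)%N ->
  ~~ [forall i, ~~ early t p (@ap_of n k L i)] ->
  contains_AP k (purchased (buy_small N b) (revealed p) t).
Proof.
move=> tn LN Nn k2 Yb; rewrite negb_forall => /existsP[i]; rewrite negbK => /forall_inP ei.
(* The start is shifted because revealed integers exceed values by one; the difference is the one
   used in [ap_of]. *)
exists (i.1.+1%:Z), (i.2.+1%:Z); split => // w wk.
have xN : (i.1 + w * i.2.+1 < N)%N.
  apply: leq_trans LN; apply: leq_ltn_trans (last_term_lt i k2).
  by rewrite leq_add2l leq_mul2r; apply/orP; right; lia.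
pose x : 'I_n := Ordinal (leq_trans xN Nn).
have xi : x \in @ap_of n k L i.
  by rewrite inE; apply/existsP; exists (Ordinal wk) => /=.
exists x.+1; last by rewrite /x /=; lia.
apply/mem_purchased => //; exists (p^-1%g x); split; rewrite ?permKV ?ei //.
by apply: (bought_buy_small Yb); rewrite ?permKV ?ei.
Qed.

Section interval_strategy.
Variables (R : realType) (n t N b : nat).

Let measurable_buy_small (xs : seq nat) (ds : seq bool) :
  measurable [set w : unit | buy_small N b xs ds].
Proof. by []. Qed.

Let budget_buy_small (w : unit) (p : {perm 'I_n}) :
  (size (purchased (buy_small N b) (revealed p) t) <= b)%N.
Proof. exact: leq_trans (size_mask_count _ _) (count_decisions_buy_small _ _ _ _). Qed.

Definition interval_strategy : strategy R n t b :=
  @Strategy R n t b _ unit (\d_tt) (fun _ => buy_small N b) measurable_buy_small budget_buy_small.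

Lemma success_interval_strategy k : success_probability interval_strategy k =
  #|[pred p : {perm 'I_n} |
     `[< contains_AP k (purchased (buy_small N b) (revealed p) t) >]]|%:R / n`!%:R.
Proof.
rewrite /success_probability; congr (_ / _).
rewrite -sum1_card natr_sum [RHS]big_mkcond; apply: eq_bigr => p _ /=.
rewrite indicE [in RHS]inE; case: asboolP => h.
  by rewrite mem_set.
by rewrite memNset.
Qed.

End interval_strategy.

(** * Failure probability of the interval strategy *)

Lemma success_probability_le1 (R : realType) n t b k (S : strategy R n t b) :
  success_probability S k <= 1.
Proof.
rewrite (le_trans (@success_probability_le _ _ _ _ k S n`!%:R _)) //.
  by move=> w; rewrite ler_nat -card_Sn max_card.
by rewrite divff // pnatr_eq0 -lt0n fact_gt0.
Qed.

(** Failure requires either more than [b] early values in the interval or no early progression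
    there; the two probabilities are added. *)
Lemma interval_strategy_bound (R : realType) n t b k L :
  (2 <= k)%N -> (0 < L)%N -> (0 < b)%N -> (2 * k <= t)%N -> (t <= n)%N -> (k * L <= n)%N ->
  (k * L)%:R * (t%:R / n%:R) <= b%:R / 2 :> R ->
  1 - (2 / b%:R + 4 ^+ k * (k%:R ^+ 2 / (L%:R * (t%:R / n%:R))
       + k%:R ^+ 4 / (L%:R ^+ 2 * (t%:R / n%:R) ^+ k)))
    <= success_probability (interval_strategy R n t (k * L) b) k.
Proof.
move=> k2 L0 b0 kt tn Ln hb; have n0 : (0 < n)%N by lia.
rewrite success_interval_strategy.
have h1 := many_small_early n0 tn Ln b0 hb.
have h2 := @no_ap_early R n t k L n0 tn Ln k2 kt L0.
rewrite lerBlDl (le_trans _ (lerD (lerD h1 h2) (lexx _))) //.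
have f0 : (0 : R) < n`!%:R by rewrite ltr0n fact_gt0.
rewrite -!mulrDl ler_pdivlMr // mul1r -!natrD ler_nat -card_Sn.
set B1 := [pred s | _]; set B2 := [pred s | _]; set W := [pred s | _].
rewrite -sum1_card !card_sum_pred -!big_split /=.
rewrite [leqLHS]big_mkcond /=; apply: leq_sum => p _.
have [Yb|//] := leqP #|[pred x : 'I_n | (x < k * L)%N && (p^-1%g x < t)%N]| b.
have [//|hX] := boolP [forall i, ~~ early t p (@ap_of n k L i)].
rewrite lt0n addn_eq0 negb_and; apply/orP; right; rewrite eqb0 negbK.
by apply/asboolP/(buy_small_wins tn (leqnn _) Ln k2 Yb hX).
Qed.

(* Chosen so that at most b/2 of the integers up to [k * interval_step] are
   expected among the first [t]. *)
Definition interval_step (n t b k : nat) : nat := (b * n) %/ (2 * t * k).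

(** With p = t/n, the choice of [L] gives Lp >= b/(4k), hence L^2 p^k = (Lp)^2 p^(k-2) >=
    r^2/(16k^2). As b >= r and r^2 >= r, every error term is a constant over [r]. *)
Lemma interval_strategy_success (R : realType) (n t b k : nat) (r : R) :
  (3 <= k)%N -> (1 <= t)%N -> (b <= t)%N -> (t <= n)%N ->
  r = b%:R / (n%:R / t%:R) `^ ((k%:R - 2) / 2) -> (2 * k)%:R <= r ->
  1 - (2 + 4 ^+ k * (4 * k%:R ^+ 3 + 16 * k%:R ^+ 6)) / r
    <= success_probability (interval_strategy R n t (k * interval_step n t b k) b) k.
Proof.
move=> k3 t1 bt tn er rk; set L := interval_step n t b k.
have n1 : (1 <= n)%N by apply: leq_trans tn.
have kR : (0 : R) < k%:R by rewrite ltr0n; lia.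
have tR : (0 : R) < t%:R by rewrite ltr0n.
have nR : (0 : R) < n%:R by rewrite ltr0n.
have r0 : 0 < r by rewrite (lt_le_trans _ rk) // ltr0n; lia.
have r1 : 1 <= r by rewrite (le_trans _ rk) // ler1n; lia.
have rb : r <= b%:R.
  rewrite er ler_pdivrMr ?powR_gt0 ?divr_gt0 // ler_peMr // -[leLHS](powRr0 (n%:R / t%:R)).
  apply: ler_powR; first by rewrite ler_pdivlMr // mul1r ler_nat.
  by rewrite divr_ge0 // subr_ge0 (ler_nat _ 2) ltnW.
(* This makes [L] positive, and b <= t then gives the bound 2k <= t required by
   [interval_strategy_bound]. *)
have bk : (2 * k <= b)%N by rewrite -(ler_nat R) (le_trans rk).
have bR : (0 : R) < b%:R by rewrite (lt_le_trans r0).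
have D0 : (0 < 2 * t * k)%N by rewrite !muln_gt0 t1 /=; lia.
have Lle : (L * (2 * t * k) <= b * n)%N by apply: leq_trunc_div.
have L1 : (0 < L)%N.
  by rewrite divn_gt0 // (_ : 2 * t * k = 2 * k * t)%N; [exact: leq_mul | ring].
(* Since L >= 1, rounding down in the division loses at most a factor 2. *)
have Lge : (b * n <= 2 * L * (2 * t * k))%N.
  have : (b * n < L.+1 * (2 * t * k))%N by apply: ltn_ceil.
  by move: (2 * t * k)%N => D; nia.
have Ln : (k * L <= n)%N.
  have : (L * (2 * t * k) <= t * n)%N by apply: leq_trans Lle _; rewrite leq_mul2r bt orbT.
  rewrite (_ : L * (2 * t * k) = t * (2 * (k * L)))%N; last by ring.
  by rewrite leq_pmul2l //; lia.
pose p : R := t%:R / n%:R.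
have p0 : 0 < p by rewrite divr_gt0.
have LR : (0 : R) < L%:R by rewrite ltr0n.
have Lp_le : (k * L)%:R * p <= b%:R / 2.
  rewrite /p mulrA ler_pdivrMr // mulrAC ler_pdivlMr // -!natrM ler_nat.
  by rewrite (leq_trans _ Lle) //; lia.
have Lp_ge : b%:R / (4 * k%:R) <= L%:R * p.
  rewrite /p mulrA ler_pdivlMr // mulrAC ler_pdivrMr ?mulr_gt0 // -!natrM ler_nat.
  by rewrite (leq_trans Lge) //; lia.
apply: le_trans (interval_strategy_bound (ltnW k3) L1 _ (leq_trans bk bt) tn Ln Lp_le); last by lia.
rewrite lerD2l lerN2 -/p.
rewrite [leRHS](_ : _ = 2 / r + 4 ^+ k * (4 * k%:R ^+ 3 / r + 16 * k%:R ^+ 6 / r)); last by ring.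
have Lp0 : 0 < L%:R * p by rewrite mulr_gt0.
apply: lerD; first by rewrite ler_wpM2l // lef_pV2.
rewrite ler_wpM2l ?exprn_ge0 //; apply: lerD.
  rewrite ler_pdivrMr // mulrAC ler_pdivlMr //.
  have : b%:R <= 4 * k%:R * (L%:R * p) by rewrite -ler_pdivrMl ?mulr_gt0 // mulrC.
  move=> /(le_trans rb) h.
  have := ler_wpM2l (exprn_ge0 2 (ltW kR)) h; rewrite exprSr.
  by move/le_trans; apply; rewrite le_eqVlt; apply/orP; left; apply/eqP; ring.
have e2 : L%:R ^+ 2 * p ^+ k = (L%:R * p) ^+ 2 * p ^+ (k - 2).
  by rewrite [(L%:R * p) ^+ 2]exprMn -[RHS]mulrA -[p ^+ 2 * _]exprD subnKC // ltnW.
have r2 : r ^+ 2 <= 16 * k%:R ^+ 2 * (L%:R ^+ 2 * p ^+ k).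
  have bLp : b%:R <= 4 * k%:R * (L%:R * p) by rewrite -ler_pdivrMl ?mulr_gt0 // mulrC.
  have : b%:R ^+ 2 <= (4 * k%:R * (L%:R * p)) ^+ 2.
    by apply: lerXn2r; rewrite ?nnegrE // mulr_ge0 // ltW.
  move=> /(ler_wpM2r (exprn_ge0 (k - 2) (ltW p0))).
  rewrite er sqr_budget_ratio // -/p e2 => /le_trans; apply.
  by rewrite le_eqVlt; apply/orP; left; apply/eqP; ring.
have Lk0 : 0 < L%:R ^+ 2 * p ^+ k by rewrite mulr_gt0 ?exprn_gt0.
rewrite ler_pdivrMr // mulrAC ler_pdivlMr //.
have rr : r <= r ^+ 2 by rewrite expr2 ler_peMl // ltW.
have := ler_wpM2l (exprn_ge0 4 (ltW kR)) (le_trans rr r2).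
by move/le_trans; apply; rewrite le_eqVlt; apply/orP; left; apply/eqP; ring.
Qed.

Lemma interval_strategy_cvg1 (R : realType) (k : nat) (t b : nat -> nat) :
  (3 <= k)%N ->
  (forall n, (1 <= n)%N -> [/\ (1 <= t n)%N, (b n <= t n)%N & (t n <= n)%N]) ->
  little_omega (fun n => (b n)%:R : R) (fun n => (n%:R / (t n)%:R) `^ ((k%:R - 2) / 2)) ->
  exists S : forall n, strategy R n (t n) (b n),
    success_probability (S n) k @[n --> \oo] --> (1 : R).
Proof.
move=> k3 htb large.
exists (fun n => interval_strategy R n (t n) (k * interval_step n (t n) (b n) k) (b n)).
pose r n : R := (b n)%:R / (n%:R / (t n)%:R) `^ ((k%:R - 2) / 2).
pose C : R := 2 + 4 ^+ k * (4 * k%:R ^+ 3 + 16 * k%:R ^+ 6).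
have ry : r n @[n --> \oo] --> +oo by exact: large.
have rV : (r n)^-1 @[n --> \oo] --> (0 : R).
  apply/gtr0_cvgV0 => //; move/cvgryPgt : ry; exact.
apply: (squeeze_cvgr (f := fun n => 1 - C * (r n)^-1) (h := fun=> 1)).
- have /cvgryPge/(_ (2 * k)%:R) rk := ry; near=> n.
  rewrite success_probability_le1 andbT.
  have n1 : (1 <= n)%N by near: n; exists 1%N.
  have [t1 bt tn] := htb n n1.
  by apply: interval_strategy_success => //; near: n.
- rewrite -[X in _ --> X](subr0 1) -[X in _ --> _ - X](mulr0 C).
  by apply: cvgB; [exact: cvg_cst | apply: cvgM => //; exact: cvg_cst].
- exact: cvg_cst.
Unshelve. all: by end_near. Qed.

Unset Implicit Arguments.

Theorem theorem1p2 (R : realType) (k : nat) (hk : (3 <= k)%N)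
  (t b : nat -> nat)
  (htb : forall n, (1 <= n)%N -> [/\ (1 <= t n)%N, (b n <= t n)%N & (t n <= n)%N]) :
  (little_omega (fun n => (t n)%:R : R) (fun n => n%:R `^ (1 - 2 / k%:R)) ->
   little_omega (fun n => (b n)%:R : R)
     (fun n => (n%:R / (t n)%:R) `^ ((k%:R - 2) / 2)) ->
   exists S : forall n, strategy R n (t n) (b n),
     success_probability (S n) k @[n --> \oo] --> (1 : R))
  /\
  (little_o (fun n => (t n)%:R : R) (fun n => n%:R `^ (1 - 2 / k%:R)) \/
   little_o (fun n => (b n)%:R : R)
     (fun n => (n%:R / (t n)%:R) `^ ((k%:R - 2) / 2)) ->
   forall S : forall n, strategy R n (t n) (b n),
     success_probability (S n) k @[n --> \oo] --> (0 : R)).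
Proof.
by split=> [_|]; [exact: interval_strategy_cvg1 | exact: success_probability_cvg0].
Qed.
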